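(* Let $X$ be one of the logics $\mathbf{KD}$, $\mathbf{KD4}$ and $\mathbf{KB}$. Then $B$-translation is faithful with respect to $X$; that is, for every formula $\phi$ of $\mathbf{L_1}$, $\vdash_X B(\phi)$ implies $\vdash_{\mathbf{L_1}}\phi$.
   Context: The system $\mathbf{L_1}$ (Leśniewski's propositional ontology): fix a countably infinite set of name variables. The atomic formulas are exactly the expressions $\epsilon ab$ with $a,b$ name variables (possibly equal); formulas are built from atomic formulas by $\vee$ and $\neg$, the other connectives being the usual classical abbreviations. $\mathbf{L_1}$ is a Hilbert-style system of classical propositional logic (with modus ponens) over these formulas with the additional axiom schemata, for all name variables $a,b,c$: (Ax1) $\epsilon ab \supset \epsilon aa$; (Ax2) $(\epsilon ab \wedge \epsilon bc) \supset \epsilon ac$; (Ax3) $(\epsilon ab \wedge \epsilon bc) \supset \epsilon ba$. $B$-translation: to each name variable $a$ corresponds a propositional variable $p_a$, with distinct name variables corresponding to distinct propositional variables. $B$ maps formulas of $\mathbf{L_1}$ to propositional modal formulas by $B(\phi\vee\psi)=B(\phi)\vee B(\psi)$, $B(\neg\phi)=\neg B(\phi)$, $B(\epsilon ab)=p_a\wedge\Box(p_a\supset p_b)\wedge\bigl(p_b\supset\Box(p_b\supset p_a)\bigr)$. The logics are the smallest normal modal logics (containing $\mathbf{K}$, closed under modus ponens, substitution and necessitation) containing the following schemata: $\mathbf{KD}$: $\Box\phi\supset\Diamond\phi$; $\mathbf{KD4}$: $\Box\phi\supset\Diamond\phi$ and $\Box\phi\supset\Box\Box\phi$; $\mathbf{KB}$: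 $\phi\supset\Box\Diamond\phi$. *)

(* Defs.v *)
From mathcomp Require Import all_boot.
Set Implicit Arguments.
Unset Strict Implicit.
Unset Printing Implicit Defensive.

(* The Hilbert-Ackermann axiom schemata, which together with modus ponens
   axiomatize classical propositional logic over negation and disjunction. *)
Section Classical.
Variables (F : Type) (neg : F -> F) (or : F -> F -> F).
Let imp A B := or (neg A) B.

Inductive cpl_axiom : F -> Prop :=
| cpl_taut A : cpl_axiom (imp (or A A) A)
| cpl_add A B : cpl_axiom (imp A (or A B))
| cpl_perm A B : cpl_axiom (imp (or A B) (or B A))
| cpl_sum A B C : cpl_axiom (imp (imp B C) (imp (or A B) (or A C))).

End Classical.

Definition name := nat.

Inductive lform : Type :=
| Eps of name & name
| LOr of lform & lform
| LNeg of lform.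

Definition LImp A B := LOr (LNeg A) B.
Definition LAnd A B := LNeg (LOr (LNeg A) (LNeg B)).

Inductive L1 : lform -> Prop :=
| L1_cpl A : cpl_axiom LNeg LOr A -> L1 A
| L1_ax1 a b : L1 (LImp (Eps a b) (Eps a a))
| L1_ax2 a b c : L1 (LImp (LAnd (Eps a b) (Eps b c)) (Eps a c))
| L1_ax3 a b c : L1 (LImp (LAnd (Eps a b) (Eps b c)) (Eps b a))
| L1_mp A B : L1 (LImp A B) -> L1 A -> L1 B.

Definition pvar := nat.

Inductive mform : Type :=
| PVar of pvar
| MOr of mform & mform
| MNeg of mform
| Box of mform.

Definition MImp A B := MOr (MNeg A) B.
Definition MAnd A B := MNeg (MOr (MNeg A) (MNeg B)).
Definition Dia A := MNeg (Box (MNeg A)).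

Fixpoint msubst (s : pvar -> mform) (A : mform) : mform :=
  match A with
  | PVar x => s x
  | MOr A1 A2 => MOr (msubst s A1) (msubst s A2)
  | MNeg A1 => MNeg (msubst s A1)
  | Box A1 => Box (msubst s A1)
  end.

Record normal_logic (L : mform -> Prop) : Prop := NormalLogic {
  normal_cpl : forall A, cpl_axiom MNeg MOr A -> L A;
  normal_K : forall A B, L (MImp (Box (MImp A B)) (MImp (Box A) (Box B)));
  normal_mp : forall A B, L (MImp A B) -> L A -> L B;
  normal_subst : forall s A, L A -> L (msubst s A);
  normal_nec : forall A, L A -> L (Box A)
}.

Definition smallest_normal (Ax : mform -> Prop) : mform -> Prop :=
  fun A => forall L, normal_logic L -> (forall C, Ax C -> L C) -> L A.

Inductive axD : mform -> Prop := AxD A : axD (MImp (Box A) (Dia A)).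
Inductive ax4 : mform -> Prop := Ax4 A : ax4 (MImp (Box A) (Box (Box A))).
Inductive axB : mform -> Prop := AxB A : axB (MImp A (Box (Dia A))).

Definition KD : mform -> Prop := smallest_normal axD.
Definition KD4 : mform -> Prop := smallest_normal (fun A => axD A \/ ax4 A).
Definition KB : mform -> Prop := smallest_normal axB.

(* [p a] is the propositional variable p_a; its injectivity is a hypothesis
   where the translation is used. *)
Fixpoint Btrans (p : name -> pvar) (A : lform) : mform :=
  match A with
  | Eps a b =>
      MAnd (MAnd (PVar (p a)) (Box (MImp (PVar (p a)) (PVar (p b)))))
           (MImp (PVar (p b)) (Box (MImp (PVar (p b)) (PVar (p a)))))
  | LOr A1 A2 => MOr (Btrans p A1) (Btrans p A2)
  | LNeg A1 => MNeg (Btrans p A1)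
  end.

(* Main.v *)
Require Import Defs.
From mathcomp Require Import all_boot.
From Stdlib Require Import Classical.
Set Implicit Arguments.
Unset Strict Implicit.
Unset Printing Implicit Defensive.

(** If [phi] is not provable in L1, a Kalmár-style completeness argument gives
    a relation [T] on names that satisfies the three axioms and refutes [phi].
    Turn [T] into a Kripke model whose root sees one world [c] for every name
    [c], with [p_a] true at the root iff [T a a] and true at [c] iff [T c a].
    At the root [B(eps a b)] then says exactly [T a b].  What the successors of
    the root see is irrelevant, as [B] does not nest boxes: let each of them see
    only itself (a serial transitive frame) or only the root (a symmetric
    frame). *)

(** * Derivations in L1 from hypotheses, and the deduction theorem *)

Inductive derives (G : lform -> Prop) : lform -> Prop :=
| derives_hyp A : G A -> derives G A
| derives_L1 A : L1 A -> derives G A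
| derives_mp A B : derives G (LImp A B) -> derives G A -> derives G B.

Lemma derives_empty A : derives (fun=> False) A -> L1 A.
Proof. by elim=> // {}A B _ AB _; apply: L1_mp AB. Qed.

Section PropositionalRules.
Variable G : lform -> Prop.
Implicit Types A B C : lform.
Notation "|- A" := (derives G A) (at level 70).

Lemma derives_cpl A : cpl_axiom LNeg LOr A -> |- A.
Proof. by move/L1_cpl/derives_L1. Qed.

Lemma derives_trans A B C : |- LImp A B -> |- LImp B C -> |- LImp A C.
Proof.
move=> AB BC; apply: derives_mp AB; apply: derives_mp BC.
exact/derives_cpl/cpl_sum.
Qed.

Lemma derives_orC A B : |- LOr A B -> |- LOr B A.
Proof. exact/derives_mp/derives_cpl/cpl_perm. Qed.

Lemma derives_orl A B : |- A -> |- LOr A B.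
Proof. exact/derives_mp/derives_cpl/cpl_add. Qed.

Lemma derives_orr A B : |- B -> |- LOr A B.
Proof. by move=> ?; apply/derives_orC/derives_orl. Qed.

Lemma derives_id A : |- LImp A A.
Proof.
by apply: (@derives_trans _ (LOr A A)); apply: derives_cpl; constructor.
Qed.

Lemma derives_or_imp A B : |- LImp A B -> |- LImp (LOr A B) B.
Proof.
move=> AB; apply: (@derives_trans _ (LOr B A)).
  exact/derives_cpl/cpl_perm.
apply: (@derives_trans _ (LOr B B)); last exact/derives_cpl/cpl_taut.
by apply: derives_mp AB; apply/derives_cpl/cpl_sum.
Qed.

(** [LImp A B] is by definition the disjunction of [LNeg A] and [B], and the second premise
    collapses it to [B]. *)
Lemma derives_cases A B : |- LImp A B -> |- LImp (LNeg A) B -> |- B.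
Proof. by move=> AB /derives_or_imp/derives_mp; apply. Qed.

Lemma derives_dni A : |- LImp A (LNeg (LNeg A)).
Proof. exact/derives_orC/derives_id. Qed.

Lemma derives_contra A B : |- LImp A B -> |- LImp (LNeg B) (LNeg A).
Proof. by move=> AB; apply/derives_orC/(derives_trans AB)/derives_dni. Qed.

(** This is the modus ponens case of the deduction theorem. Contraposing [LImp A B] gives that
    [LImp B C] implies [LImp A C]; chaining with the first premise leaves [A] twice as an
    antecedent, and the repetition is contracted. *)
Lemma derives_S A B C :
  |- LImp A (LImp B C) -> |- LImp A B -> |- LImp A C.
Proof.
move=> ABC /derives_contra nBnA.
have BCAC : |- LImp (LImp B C) (LImp A C).
  apply: (@derives_trans _ (LOr C (LNeg B))).
    exact/derives_cpl/cpl_perm.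
  apply: (@derives_trans _ (LOr C (LNeg A))).
    by apply: derives_mp nBnA; apply/derives_cpl/cpl_sum.
  exact/derives_cpl/cpl_perm.
have AAC := derives_trans ABC BCAC.
apply: derives_mp AAC; apply: derives_or_imp.
exact/derives_cpl/cpl_add.
Qed.

Lemma derives_nor A B : |- LNeg A -> |- LNeg B -> |- LNeg (LOr A B).
Proof.
move=> nA; apply: derives_mp; apply/derives_contra/derives_or_imp.
exact: derives_orl.
Qed.

Lemma derives_nn A : |- A -> |- LNeg (LNeg A).
Proof. exact/derives_mp/derives_dni. Qed.

Lemma derives_and A B : |- A -> |- B -> |- LAnd A B.
Proof. by move=> ? ?; apply: derives_nor; apply: derives_nn. Qed.

Lemma derives_absurd A B : |- A -> |- LNeg A -> |- B.
Proof. by move=> a na; apply: derives_mp a; apply: derives_orl. Qed.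

End PropositionalRules.

Lemma derives_deduction (G : lform -> Prop) (A B : lform) :
  derives (fun C => C = A \/ G C) B -> derives G (LImp A B).
Proof.
elim=> [C [->|GC]|C LC|C D _ ACD _ AC].
- exact: derives_id.
- by apply/derives_orr/derives_hyp.
- by apply/derives_orr/derives_L1.
- exact: derives_S ACD AC.
Qed.

Lemma derives_sub (G H : lform -> Prop) (A : lform) :
  (forall C, G C -> H C) -> derives G A -> derives H A.
Proof.
move=> GH; elim=> [C /GH|C|C D _ HCD _].
- exact: derives_hyp.
- exact: derives_L1.
- exact: derives_mp.
Qed.

(** * Completeness of L1 for its relational models *)

Definition literal (T : rel name) (x : name * name) : lform :=
  if T x.1 x.2 then Eps x.1 x.2 else LNeg (Eps x.1 x.2).

Definition literals (T : rel name) (l : seq (name * name)) (A : lform) : Prop :=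
  exists2 x, x \in l & A = literal T x.

(** The pairs are discharged one at a time: if [A] follows from both signs of the atom at [x]
    together with the literals on [l], case analysis removes that atom. *)
Lemma literals_elim (l : seq (name * name)) (A : lform) :
  (forall T, derives (literals T l) A) -> L1 A.
Proof.
move=> lA; apply: derives_empty; elim: l lA => [|x l IHl] lA.
  by apply: derives_sub (lA (fun _ _ => false)) => C [].
apply: IHl => T; have [xl|xNl] := boolP (x \in l).
  apply: derives_sub (lA T) => C [y yxl ->]; exists y => //.
  by case/predU1P: yxl => [->|].
(* [T' b] takes the value [b] at [x] and agrees with [T] on [l], where [x] does not occur. Its
   literals on [x :: l] are thus those of [T] on [l] and the literal at [x] of sign [b]. *)
pose T' b : rel name := fun u v => if (u, v) == x then b else T u v.
have case_x b : derives (literals T l)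
    (LImp (if b then Eps x.1 x.2 else LNeg (Eps x.1 x.2)) A).
  apply/derives_deduction/(derives_sub _ (lA (T' b))) => C [y].
  case/predU1P=> [-> ->|yl ->]; [left | right; exists y => //].
    by rewrite /literal /T' -surjective_pairing eqxx.
  by rewrite /literal /T' -surjective_pairing (negbTE (memPn xNl y yl)).
exact: derives_cases (case_x true) (case_x false).
Qed.

Fixpoint leval (T : rel name) (A : lform) : bool :=
  match A with
  | Eps a b => T a b
  | LOr A1 A2 => leval T A1 || leval T A2
  | LNeg A1 => ~~ leval T A1
  end.

Fixpoint lnames (A : lform) : seq name :=
  match A with
  | Eps a b => [:: a; b]
  | LOr A1 A2 => lnames A1 ++ lnames A2
  | LNeg A1 => lnames A1
  end.

Lemma kalmar (G : lform -> Prop) (T : rel name) (N : seq name) (A : lform) :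
  {in N &, forall a b, derives G (literal T (a, b))} ->
  {subset lnames A <= N} ->
  derives G (if leval T A then A else LNeg A).
Proof.
move=> GT; elim: A => [a b|A IHA B IHB|A IHA] /= AN.
- by apply: GT; apply: AN; rewrite !inE eqxx ?orbT.
- have {}IHA : derives G (if leval T A then A else LNeg A).
    by apply: IHA => x xA; apply: AN; rewrite mem_cat xA.
  have {}IHB : derives G (if leval T B then B else LNeg B).
    by apply: IHB => x xB; apply: AN; rewrite mem_cat xB orbT.
  case: (leval T A) IHA => /= [|nA]; first exact: derives_orl.
  case: (leval T B) IHB => [|nB]; first exact: derives_orr.
  exact: derives_nor.
- by case: (leval T A) (IHA AN) => //=; apply: derives_nn.
Qed.

Record L1_model (T : rel name) : Prop := L1Model {
  L1_model1 : forall a b, T a b -> T a a;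
  L1_model2 : forall a b c, T a b -> T b c -> T a c;
  L1_model3 : forall a b c, T a b -> T b c -> T b a
}.

(** It suffices to derive [A] from each choice of signs for the finitely many atoms over the names
    of [A]. An inconsistent choice derives everything; a consistent one comes from a model, where
    [A] is true, so that [kalmar] applies. *)
Lemma L1_complete (A : lform) :
  (forall T, L1_model T -> leval T A) -> L1 A.
Proof.
move=> validA; pose N := lnames A.
apply: (@literals_elim [seq (a, b) | a <- N, b <- N]) => T.
set G := literals T _.
(* Making every atom outside [N] false lets the finitely many literals determine a relation on all
   names. *)
pose T' : rel name := fun a b => [&& a \in N, b \in N & T a b].
have GT' : {in N &, forall a b, derives G (literal T' (a, b))}.
  move=> a b aN bN; apply: derives_hyp; exists (a, b).
    exact: allpairs_f.
  by rewrite /literal /T' /= aN bN.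
have T'N a b : T' a b -> [/\ a \in N, b \in N & derives G (Eps a b)].
  move=> Tab; have /and3P[aN bN _] := Tab.
  by have := GT' a b aN bN; rewrite /literal /= Tab.
(* Arguing by contradiction, assume that [G] does not derive [A]; then [G] is consistent, and an
   atom over [N] that it derives must hold in [T']. Each model condition thus reduces to an axiom of
   L1. *)
apply: NNPP => consG.
have GT'_sound a b : a \in N -> b \in N -> derives G (Eps a b) -> T' a b.
  move=> aN bN Gab; apply: contra_notT consG => nTab.
  apply: derives_absurd Gab _.
  by have := GT' a b aN bN; rewrite /literal /= (negbTE nTab).
apply: consG.
have modelT' : L1_model T'.
  split=> [a b /T'N[aN bN ab]|a b c|a b c].
  - by apply: GT'_sound => //; apply: derives_mp ab; apply/derives_L1/L1_ax1.
  - case/T'N=> aN bN ab /T'N[_ cN bc]; apply: GT'_sound => //.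
    by apply: derives_mp (derives_and ab bc); apply/derives_L1/L1_ax2.
  - case/T'N=> aN bN ab /T'N[_ cN bc]; apply: GT'_sound => //.
    by apply: derives_mp (derives_and ab bc); apply/derives_L1/L1_ax3.
by have := @kalmar G T' N A GT' (fun x => id); rewrite validA.
Qed.

(** * Kripke semantics and soundness *)

Section Kripke.
Variables (W : Type) (R : W -> W -> Prop).

Fixpoint forces (V : W -> pvar -> Prop) (w : W) (A : mform) : Prop :=
  match A with
  | PVar x => V w x
  | MOr A1 A2 => forces V w A1 \/ forces V w A2
  | MNeg A1 => ~ forces V w A1
  | Box A1 => forall u, R w u -> forces V u A1
  end.

Definition valid (A : mform) : Prop := forall V w, forces V w A.

Lemma forces_imp V w A B :
  forces V w (MImp A B) <-> (forces V w A -> forces V w B).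
Proof. by move: (classic (forces V w A)) => /=; tauto. Qed.

Lemma forces_box_imp V w A B :
  forces V w (Box (MImp A B)) <->
  (forall u, R w u -> forces V u A -> forces V u B).
Proof. by split=> AB u /AB /(forces_imp V u A B). Qed.

Lemma forces_and V w A B :
  forces V w (MAnd A B) <-> forces V w A /\ forces V w B.
Proof.
by move: (classic (forces V w A)) (classic (forces V w B)) => /=; tauto.
Qed.

Lemma forces_subst V s w A :
  forces V w (msubst s A) <-> forces (fun u x => forces V u (s x)) w A.
Proof.
elim: A w => [x|A IHA B IHB|A IHA|A IHA] w //=.
- by move: (IHA w) (IHB w); tauto.
- by move: (IHA w); tauto.
- by split=> wA u /wA /IHA.
Qed.

(** Closure under substitution rests on [valid] ranging over all valuations: a substitution amounts
    to a change of valuation. *)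
Lemma valid_normal : normal_logic valid.
Proof.
split.
- move=> _ [A|A B|A B|A B C] V w /=.
  + by move: (classic (forces V w A)); tauto.
  + by move: (classic (forces V w A)); tauto.
  + by move: (classic (forces V w A)) (classic (forces V w B)); tauto.
  + move: (classic (forces V w A)) (classic (forces V w B)).
    by move: (classic (forces V w C)); tauto.
- move=> A B V w; apply/forces_imp => /forces_box_imp wAB.
  by apply/forces_imp => wA u wu; apply: wAB (wA u wu).
- by move=> A B AB vA V w; have /forces_imp := AB V w; apply.
- by move=> s A vA V w; apply/forces_subst.
- by move=> A vA V w u _; apply: vA.
Qed.

Lemma valid_axD A : (forall w, exists u, R w u) -> axD A -> valid A.
Proof.
move=> serial [{}A] V w; apply/forces_imp => /= wA wNA.
by have [u wu] := serial w; apply: wNA wu (wA u wu).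
Qed.

Lemma valid_ax4 A : (forall u v w, R u v -> R v w -> R u w) -> ax4 A -> valid A.
Proof.
move=> trans [{}A] V w; apply/forces_imp => /= wA u wu v uv.
exact/wA/(trans _ _ _ wu uv).
Qed.

Lemma valid_axB A : (forall u v, R u v -> R v u) -> axB A -> valid A.
Proof.
move=> sym [{}A] V w; apply/forces_imp => /= wA u wu uNA.
exact: uNA (sym _ _ wu) wA.
Qed.

End Kripke.

(** * The star models and faithfulness *)

Definition reflexive_star (u v : option name) : Prop :=
  if v is Some c then u = None \/ u = Some c else False.

Definition symmetric_star (u v : option name) : Prop :=
  (u == None) != (v == None).

(** [None] is the root and [Some c] the world of the name [c]. The default in [odflt a w] makes the
    root read [T a a]. Variables outside the range of [p] are false everywhere. *)
Definition star_val (p : name -> pvar) (T : rel name) (w : option name)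
    (x : pvar) : Prop :=
  exists2 a, x = p a & T (odflt a w) a.

Lemma star_valE p T w a :
  injective p -> star_val p T w (p a) <-> T (odflt a w) a.
Proof. by move=> pI; split=> [[b /pI ->]//|]; exists a. Qed.

(** At the root a boxed implication from [p c] to [p d] is an inclusion: every [e] with [T e c] has
    [T e d]. The axioms turn the atomic case into [T a b]. *)
Lemma forces_Btrans (R : option name -> option name -> Prop)
    (p : name -> pvar) (T : rel name) (A : lform) :
  injective p -> L1_model T ->
  (forall u, R None u <-> exists c, u = Some c) ->
  forces R (star_val p T) None (Btrans p A) <-> leval T A.
Proof.
move=> pI [T1 T2 T3] Rroot; elim: A => [a b|A IHA B IHB|A IHA]; last 2 first.
- by rewrite /= IHA IHB; split=> /orP.
- by rewrite /= IHA; split=> [/negP|/negP].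
have boxE c d :
    forces R (star_val p T) None (Box (MImp (PVar (p c)) (PVar (p d)))) <->
    (forall e, T e c -> T e d).
  rewrite forces_box_imp; split=> [cd e|cd u /Rroot[e ->]].
    move: (cd (Some e)); rewrite /= !star_valE //; apply.
    by apply/Rroot; exists e.
  by rewrite /= !star_valE //; apply: cd.
rewrite [Btrans _ _]/= !forces_and forces_imp !boxE /= !star_valE //=.
(* The inclusion is used at the world of [a] itself, where [T a a] gives [T a b]. *)
split=> [[[aa ab] _]|ab]; first exact: ab.
split; first by split=> [|e ea]; [exact: T1 ab | exact: T2 ea ab].
(* Here the third axiom gives [T b a] from [T a b] and [T b b]. *)
by move=> bb e eb; apply: T2 eb (T3 _ _ _ ab bb).
Qed.

Lemma faithful_of_star (R : option name -> option name -> Prop)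
    (p : name -> pvar) (phi : lform) :
  injective p -> (forall u, R None u <-> exists c, u = Some c) ->
  valid R (Btrans p phi) -> L1 phi.
Proof.
move=> pI Rroot vphi; apply: L1_complete => T modelT.
exact/(forces_Btrans phi pI modelT Rroot).
Qed.

Lemma reflexive_star_root u : reflexive_star None u <-> exists c, u = Some c.
Proof. by case: u => [c|]; split=> [|[]] //=; [exists c | left]. Qed.

Lemma symmetric_star_root u : symmetric_star None u <-> exists c, u = Some c.
Proof. by case: u => [c|]; split=> [|[]] //=; exists c. Qed.

Lemma reflexive_star_serial u : exists v, reflexive_star u v.
Proof.
by case: u => [c|]; [exists (Some c); right | exists (Some 0); left].
Qed.

Lemma reflexive_star_trans u v w :
  reflexive_star u v -> reflexive_star v w -> reflexive_star u w.
(* A world that is seen is not the root, so it sees only itself and the second step stays at [v]. *)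
Proof. by case: w v => [c|] // [d|] //= ud [] // [<-]. Qed.

Lemma symmetric_star_sym u v : symmetric_star u v -> symmetric_star v u.
Proof. by rewrite /symmetric_star eq_sym. Qed.

Theorem theorem7p10 (X : mform -> Prop) (hX : X = KD \/ X = KD4 \/ X = KB)
    (p : name -> pvar) (p_inj : injective p) (phi : lform) :
  X (Btrans p phi) -> L1 phi.
Proof.
have validD A := @valid_axD _ _ A reflexive_star_serial.
case: hX => [->|[->|->]] Xphi.
- apply: (faithful_of_star p_inj reflexive_star_root).
  (* The smallest normal logic lies inside every normal logic with its axioms, in particular inside
     the set of formulas valid on the star. *)
  exact: Xphi (valid_normal _) validD.
- apply: (faithful_of_star p_inj reflexive_star_root).
  apply: Xphi (valid_normal _) _ => C [/validD//|].
  exact/valid_ax4/reflexive_star_trans.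
- apply: (faithful_of_star p_inj symmetric_star_root).
  apply: Xphi (valid_normal _) _ => C.
  exact/valid_axB/symmetric_star_sym.
Qed.
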